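(* Let $\mathbf{X}=\{X_1,\ldots,X_n\}$ be a set of random variables, with Bayesian-network structures, likelihoods and parameter priors as described in the context. Given likelihood modularity, covered-arc-reversal equivalence and marginal likelihood equivalence, we can construct the likelihood $p(\mathbf{x}\mid\theta_s,S^h)$ for any structure $S$ for $\mathbf{X}$ given the likelihood $p(\mathbf{x}\mid\theta_{sc},S_c^h)$ for any complete structure $S_c$ for $\mathbf{X}$.
   Context: **Structures.** A structure $S$ for $\mathbf{X}=\{X_1,\ldots,X_n\}$ is a directed acyclic graph with node set $\mathbf{X}$; $\mathbf{Pa}_i^S$ (or $\mathbf{Pa}_i$) is the set of parents of $X_i$ in $S$. With the variables ordered so that parents precede children, $S$ represents the conditional-independence assertions that each $X_i$ is independent of its non-parent predecessors given its parents. Two structures are independence equivalent if they represent the same assertions of conditional independence. A structure is complete if it has no missing arcs; all complete structures for $\mathbf{X}$ are independence equivalent. An arc between two nodes is covered if those two nodes would have the same parents if the arc were removed; a covered arc reversal reverses a single covered arc. **Likelihoods and priors.** $\mathbf{x}$ denotes a value of $\mathbf{X}$, $x_i$ a value of $X_i$, and $\mathbf{pa}_i$ (or $\mathbf{pa}_i^S$) a value of the parent set of $X_i$ in $S$. $S^h$ is the hypothesis that the joint distribution of $\mathbf{X}$ factors according to $S$; every structure hypothesis is possible, i.e. $p(S^h)>0$ for all $S$. For each $S$ there is a finite set of parameters $\theta_s=(\theta_1,\ldots,\theta_n)$, assumed absolutely continuous, with prior density $p(\theta_s\mid S^h)$, and the likelihood is $p(\mathbf{x}\mid\theta_s,S^h)=\prod_{i=1}^n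 p(x_i\mid\mathbf{pa}_i,\theta_i,S^h)$. The local likelihoods $p(x_i\mid\mathbf{pa}_i,\theta_i,S^h)$ are restricted to some family $\mathcal F$ of probability distributions. **Likelihood modularity.** For every structure $S$ and every $X_i$, $p(x_i\mid\mathbf{pa}_i^S,\theta_i,S^h)=p(x_i\mid\mathbf{pa}_i^S,\theta_i)$; that is, the local likelihood of $X_i$ depends on $S$ only through the parents of $X_i$. **Covered-arc-reversal equivalence.** Any two structures for $\mathbf{X}$ that differ by a single covered arc reversal are distribution equivalent with respect to $\mathcal F$. Here $S_1,S_2$ are distribution equivalent with respect to $\mathcal F$ if for every $\theta_{s1}$ there is a $\theta_{s2}$ with $p(\mathbf{x}\mid\theta_{s1},S_1^h)=p(\mathbf{x}\mid\theta_{s2},S_2^h)$, and vice versa. (Since independence-equivalent structures can be transformed into each other by covered arc reversals, independence-equivalent structures are then distribution equivalent.) **Technical assumptions.** The parameters $\theta_i$ are uniquely determined given the local likelihood $p(x_i\mid\mathbf{pa}_i,\theta_i)$. Consequently, for distribution-equivalent $S_1,S_2$ there is a one-to-one mapping $\theta_{s2}=\Theta_{s2}(\theta_{s1})$ such that $\theta_{s2}$ is the unique parameter value of $S_2$ with $p(\mathbf{x}\mid\theta_{s1},S_1^h)=p(\mathbf{x}\mid\theta_{s2},S_2^h)$. The Jacobian $|\partial\theta_{s1}/\partial\theta_{s2}|$ exists and is non-zero for all values of $\theta_{s1}$. **Marginal likelihood equivalence.** For any two independence-equivalent structures $S_1,S_2$ for $\mathbf{X}$ and all values of $\theta_{s1}$: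 $p(\mathbf{x}\mid\Theta_{s2}(\theta_{s1}),S_2^h)=p(\mathbf{x}\mid\theta_{s1},S_1^h)$ and $p(\theta_{s2}\mid S_2^h)=|\partial\theta_{s1}/\partial\theta_{s2}|\,p(\theta_{s1}\mid S_1^h)$, where $\theta_{s2}=\Theta_{s2}(\theta_{s1})$.
   Formalization: Adds the assumption that for every structure and parameter value, each value of each parent set has positive probability density; otherwise a local likelihood at an impossible parent value need not be determined by any complete structure's likelihood, and the claim fails. *)

(* Defs.v *)
From HB Require Import structures.
From mathcomp Require Import all_boot all_order all_fingroup all_algebra.
From mathcomp Require Import all_classical all_reals all_analysis.

Set Implicit Arguments.
Unset Strict Implicit.
Unset Printing Implicit Defensive.

Import Order.TTheory GRing.Theory Num.Theory.
Import numFieldNormedType.Exports.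

Local Open Scope classical_set_scope.
Local Open Scope ring_scope.

(** * Structures *)

Section Dag.
Variable n : nat.

Definition dag_arc (pa : {ffun 'I_n -> {set 'I_n}}) : rel 'I_n :=
  fun i j => i \in pa j.

(* Since [connect] is reflexive, this also excludes loops. *)
Definition acyclic (pa : {ffun 'I_n -> {set 'I_n}}) : bool :=
  [forall i, forall j, dag_arc pa i j ==> ~~ connect (dag_arc pa) j i].

Record dag := Dag {
  parents :> {ffun 'I_n -> {set 'I_n}};
  dag_acyclic : acyclic parents }.

HB.instance Definition _ := [isSub for parents].
HB.instance Definition _ := [Finite of dag by <:].

Definition pa (S : dag) (i : 'I_n) : {set 'I_n} := parents S i.

Definition complete_dag (S : dag) : Prop :=
  forall i j, i != j -> (i \in pa S j) || (j \in pa S i).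

Definition covered_arc (S : dag) (a b : 'I_n) : Prop :=
  a \in pa S b /\ pa S a = (pa S b :\ a)%SET.

Definition covered_arc_reversal (S1 S2 : dag) : Prop :=
  exists a b, [/\ covered_arc S1 a b,
    pa S2 a = (b |: pa S1 a)%SET,
    pa S2 b = (pa S1 b :\ a)%SET &
    forall i, i != a -> i != b -> pa S2 i = pa S1 i].

Definition topological_order (S : dag) (o : {perm 'I_n}) : Prop :=
  forall i j, i \in pa S j -> (o i < o j)%N.

End Dag.

(** * Conditional-independence assertions of a structure *)

Section Independence.
Variables (R : realType) (n : nat).

Section Finite_distribution.
Variables (V : finType) (P : {ffun 'I_n -> V} -> R).

Definition joint_pmf : Prop := (forall v, 0 <= P v) /\ \sum_v P v = 1.

Definition pr (A : {set 'I_n}) (v : {ffun 'I_n -> V}) : R :=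
  \sum_(w : {ffun 'I_n -> V} | [forall j in A, w j == v j]) P w.

Definition cond_indep (A B C : {set 'I_n}) : Prop := forall v,
  pr (A :|: B :|: C)%SET v * pr C v = pr (A :|: C)%SET v * pr (B :|: C)%SET v.

Definition satisfies_assertions (S : dag n) : Prop :=
  forall o : {perm 'I_n}, topological_order S o -> forall i,
    cond_indep [set i]%SET
      ([set j : 'I_n | (o j < o i)%N] :\: pa S i)%SET (pa S i).

End Finite_distribution.

(* The assertions represented by a structure are those entailed by its ordered
   Markov assertions. Entailment is a property of the graph, so it is tested on
   joint distributions over arbitrary finite value spaces and not on the value
   spaces of a particular model, which may be degenerate. *)
Definition represents (S : dag n) (A B C : {set 'I_n}) : Prop :=
  forall (V : finType) (P : {ffun 'I_n -> V} -> R),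
    joint_pmf P -> satisfies_assertions P S -> cond_indep P A B C.

Definition independence_equivalent (S1 S2 : dag n) : Prop :=
  forall A B C, represents S1 A B C <-> represents S2 A B C.

End Independence.

(** * Densities on a finite product *)

Section Product.
Variables (R : realType) (I : finType) (d : I -> measure_display).
Variables (T : forall i, measurableType (d i)).
Variables (mu : forall i, {sigma_finite_measure set (T i) -> \bar R}).

Notation X := (forall i, T i).

Definition cylinders : set (set X) :=
  [set A | exists i (B : set (T i)),
     measurable B /\ A = [set x : X | B (x i)]].

Definition product_measurable (f : X -> R) : Prop :=
  measurable_fun setT (f : g_sigma_algebraType cylinders -> R).

Definition int_coord (i : I) (g : X -> \bar R) : X -> \bar R :=
  fun x => (\int[mu i]_y g (dfwith x i y))%E.

(* Iterated integral over the coordinates in [U]; for nonnegative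
   [product_measurable] integrands the order is immaterial (Tonelli). *)
Definition int_over (U : {set I}) (g : X -> \bar R) : X -> \bar R :=
  foldr int_coord g (enum U).

Definition joint_density (f : X -> R) : Prop :=
  [/\ product_measurable f, forall x, 0 <= f x &
      forall x, int_over [set: I]%SET (EFin \o f) x = 1%E].

(* Conditional density of coordinate [i] given the other coordinates. *)
Definition conditional_density (i : I) (f : X -> R) : Prop :=
  [/\ product_measurable f, forall x, 0 <= f x &
      forall x, int_coord i (EFin \o f) x = 1%E].

(* p(x_U) and p(x_i | x_U) for the joint density f, as functions of the full x. *)
Definition marginal (f : X -> R) (U : {set I}) : X -> \bar R :=
  int_over (~: U)%SET (EFin \o f).

Definition conditional (f : X -> R) (i : I) (U : {set I}) : X -> R :=
  fun x => fine (marginal f (i |: U)%SET x) / fine (marginal f U x).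

End Product.

(* Joint densities with respect to Lebesgue measure on R^m. *)
Definition lebesgue_joint_density (R : realType) (m : nat) (f : 'rV[R]_m -> R) : Prop :=
  @joint_density R 'I_m (fun=> _) (fun=> measurableTypeR R)
    (fun=> @lebesgue_measure R) (fun t => f (\row_j t j)).

(* |d F / d v|; the value is meaningful when m1 = m2, in which case
   [conform_mx] only adjusts the type of the Jacobian matrix. *)
Definition abs_jacobian (R : realType) (m1 m2 : nat)
    (F : 'rV[R]_m1 -> 'rV[R]_m2) (v : 'rV[R]_m1) : R :=
  `|\det (conform_mx (0 : 'M[R]_m1) ('J F v))|.

(** * Models *)

Section Model.
Variables (R : realType) (n : nat) (d : 'I_n -> measure_display).
Variables (T : forall i, measurableType (d i)).
Variables (mu : forall i, {sigma_finite_measure set (T i) -> \bar R}).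

Notation X := (forall i, T i).

(* Parameters of one variable, together with its local likelihood written as a
   function of the full x. [llik_out] makes Leibniz equality of local models
   independent of values outside the parameter domain. *)
Record local_model := LocalModel {
  ldim : nat;
  ldom : set 'rV[R]_ldim;
  llik : 'rV[R]_ldim -> X -> R;
  llik_out : forall t, ~ ldom t -> llik t = cst 0 }.

Definition sdim (loc : dag n -> 'I_n -> local_model) (S : dag n) : nat :=
  (\sum_(i < n) ldim (loc S i))%N.

(* [repar S2 t1] is the parameter of S2 corresponding to the parameter t1 of S1
   (Theta_{s2}(theta_{s1})); like [prior] it is a total function of which only
   the values on the parameter domain matter. *)
Record bn_model := BNModel {
  hyp_prob : dag n -> R;                               (* p(S^h) *)
  loc : dag n -> 'I_n -> local_model;                  (* p(x_i|pa_i,theta_i,S^h) *)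
  prior : forall S, 'rV[R]_(sdim loc S) -> R;          (* p(theta_s|S^h) *)
  repar : forall S1 S2, 'rV[R]_(sdim loc S1) -> 'rV[R]_(sdim loc S2) }.

Variable M : bn_model.

Definition params (S : dag n) := 'rV[R]_(sdim (loc M) S).

Definition lpar (S : dag n) (theta : params S) (i : 'I_n) :
  'rV[R]_(ldim (loc M S i)) := submxrow theta i.

Definition param_dom (S : dag n) : set (params S) :=
  [set theta | forall i, ldom (lpar theta i)].

Definition lik (S : dag n) (theta : params S) (x : X) : R :=
  \prod_(i < n) llik (lpar theta i) x.

(* Equality of local parameters of possibly different structures: the local
   models coincide and the parameter values coincide. *)
Definition same_lpar (m1 m2 : local_model)
    (t1 : 'rV[R]_(ldim m1)) (t2 : 'rV[R]_(ldim m2)) : Prop :=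
  existT (fun m => 'rV[R]_(ldim m)) m1 t1 =
  existT (fun m => 'rV[R]_(ldim m)) m2 t2.

Definition structures_possible : Prop :=
  (forall S, 0 < hyp_prob M S) /\ \sum_S hyp_prob M S = 1.

Definition local_likelihoods_in (F : forall i : 'I_n, set (X -> R)) : Prop :=
  (forall i f, F i f -> conditional_density mu i f) /\
  forall S i t, ldom t ->
    F i (llik (l := loc M S i) t) /\
    forall x y, (forall j, j \in (i |: pa S i)%SET -> x j = y j) ->
      llik (l := loc M S i) t x = llik t y.

Definition prior_densities : Prop := forall S,
  lebesgue_joint_density (prior (b := M) (S := S)) /\
  forall theta : params S, ~ param_dom theta -> prior (b := M) theta = 0.

(* The conditioning events of the local likelihoods have positive density, so
   that p(x_i | pa_i) is a conditional density of the joint likelihood. *)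
Definition parents_possible : Prop := forall S (theta : params S), param_dom theta ->
  forall i x, (0 < marginal mu (lik theta) (pa S i) x)%E.

Definition likelihood_modularity : Prop :=
  forall S1 S2 i, pa S1 i = pa S2 i -> loc M S1 i = loc M S2 i.

Definition distribution_equivalent (S1 S2 : dag n) : Prop :=
  (forall t1 : params S1, param_dom t1 ->
     exists2 t2 : params S2, param_dom t2 & forall x, lik t1 x = lik t2 x) /\
  (forall t2 : params S2, param_dom t2 ->
     exists2 t1 : params S1, param_dom t1 & forall x, lik t1 x = lik t2 x).

Definition covered_arc_reversal_equivalence : Prop :=
  forall S1 S2, covered_arc_reversal S1 S2 -> distribution_equivalent S1 S2.

Definition local_parameters_identified : Prop :=
  forall S i, set_inj (ldom (l := loc M S i)) (llik (l := loc M S i)).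

(* The Jacobian is that of theta_{s1} as a function of theta_{s2}. *)
Definition reparametrizations : Prop :=
  forall S1 S2, distribution_equivalent S1 S2 ->
  forall (t1 : params S1), param_dom t1 ->
    [/\ forall t2 : params S2,
          t2 = repar S2 t1 <-> param_dom t2 /\ forall x, lik t1 x = lik t2 x,
        sdim (loc M) S1 = sdim (loc M) S2,
        differentiable (repar (b := M) S1 (S1 := S2)) (repar S2 t1) &
        abs_jacobian (repar (b := M) S1 (S1 := S2)) (repar S2 t1) != 0].

Definition marginal_likelihood_equivalence : Prop :=
  forall S1 S2, independence_equivalent R S1 S2 ->
  forall t1 : params S1, param_dom t1 ->
    [/\ param_dom (repar S2 t1 : params S2),
        forall x, lik (repar S2 t1 : params S2) x = lik t1 x &
        prior (repar S2 t1) =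
          abs_jacobian (repar (b := M) S1 (S1 := S2)) (repar S2 t1) * prior t1].

End Model.

(* Main.v *)
(* Take phi_i to be the local likelihood of X_i in S. All complete structures are
   independence equivalent, as they assert nothing, so marginal likelihood
   equivalence identifies their joint likelihoods. Ordering the variables with
   pa_i first and X_i next gives a complete structure C in which X_i has the same
   parents as in S; by likelihood modularity its local likelihood is the one in S,
   and since pa_i and pa_i + X_i are ancestral in C, it is the conditional of the
   joint likelihood of C, hence of that of Sc. Each local parameter of S extends
   to a parameter of C because the prior of C, having total mass 1, forces the
   parameter domain of C to be nonempty. *)
Require Import Defs.
From HB Require Import structures.
From mathcomp Require Import all_boot all_order all_fingroup all_algebra.
From mathcomp Require Import all_classical all_reals all_analysis.
From mathcomp Require Import measurable_realfun zify.

Set Implicit Arguments.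
Unset Strict Implicit.
Unset Printing Implicit Defensive.

Import Order.TTheory GRing.Theory Num.Theory.
Import numFieldNormedType.Exports.

Local Open Scope classical_set_scope.
Local Open Scope ring_scope.

(** * Iterated integrals over a finite product of measure spaces *)

Section ProductIntegral.
Variables (R : realType) (I : finType) (d : I -> measure_display).
Variables (T : forall i, measurableType (d i)).
Variables (mu : forall i, {sigma_finite_measure set (T i) -> \bar R}).

Local Notation X := (forall i, T i).
Local Notation mX := (g_sigma_algebraType (@cylinders I d T)).

Lemma measurable_fun_product d' (U : measurableType d') (h : U -> X) :
  (forall i, measurable_fun setT (fun u => h u i)) ->
  measurable_fun setT (h : U -> mX).
Proof.
move=> mh; apply: (@measurability _ _ U mX setT h (@cylinders I d T)) => //.
move=> _ [_ [i [B [mB ->]]] <-].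
exact: mh.
Qed.

Lemma measurableT_comp_product d' (U : measurableType d') d'' (V : measurableType d'')
    (g : X -> V) (h : U -> X) :
  measurable_fun setT (g : mX -> V) ->
  (forall i, measurable_fun setT (fun u => h u i)) ->
  measurable_fun setT (g \o h).
Proof.
by move=> mg mh; exact: (measurableT_comp mg (measurable_fun_product mh)).
Qed.

Lemma measurable_fun_coord i : measurable_fun setT (fun x : mX => x i).
Proof.
move=> _ B mB; rewrite setTI; apply: sub_sigma_algebra.
by exists i, B.
Qed.

Lemma measurable_fun_dfwith d' (U : measurableType d') (h : U -> X) i
    (k : U -> T i) :
  (forall j, measurable_fun setT (fun u => h u j)) -> measurable_fun setT k ->
  forall j, measurable_fun setT (fun u => dfwith (h u) i (k u) j).
Proof.
move=> mh mk j; have [<-|ij] := eqVneq i j.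
  by apply: eq_measurable_fun mk => u _; rewrite dfwithin.
by apply: eq_measurable_fun (mh j) => u _; rewrite dfwithout.
Qed.

Lemma dfwithC (x : X) i j (y : T i) (z : T j) : i != j ->
  dfwith (dfwith x i y) j z = dfwith (dfwith x j z) i y.
Proof.
move=> ij; apply: functional_extensionality_dep => k.
have [jk|jk] := eqVneq j k.
  by subst k; rewrite dfwithin dfwithout ?dfwithin.
have [ik|ik] := eqVneq i k.
  by subst k; rewrite dfwithout// !dfwithin.
by rewrite !dfwithout.
Qed.

(** This class is stable under [int_coord], so Tonelli's theorem can be applied at every stage of an
    iterated integral. *)
Definition tonelli_integrand (g : X -> \bar R) :=
  measurable_fun setT (g : mX -> \bar R) /\ forall x, (0 <= g x)%E.

Lemma int_coord_tonelli i g :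
  tonelli_integrand g -> tonelli_integrand (int_coord mu i g).
Proof.
move=> [mg g0]; split; last by move=> x; apply: integral_ge0.
pose f (p : mX * T i) := g (dfwith (p.1 : X) i p.2).
have mf : measurable_fun setT f.
  apply: (measurableT_comp_product mg); apply: measurable_fun_dfwith => // j.
  exact: (measurableT_comp (@measurable_fun_coord j)).
exact: (measurable_fun_fubini_tonelli_F (m2 := mu i) f mf (fun=> g0 _)).
Qed.

(** For distinct coordinates this is Tonelli on [T i * T j], all other coordinates being frozen at
    those of [x]. *)
Lemma int_coordC i j g : tonelli_integrand g ->
  int_coord mu i (int_coord mu j g) = int_coord mu j (int_coord mu i g).
Proof.
move=> [mg g0]; have [<-//|ij] := eqVneq i j.
apply: functional_extensionality_dep => x; rewrite /int_coord.
pose f (p : T i * T j) := g (dfwith (dfwith x i p.1) j p.2).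
have mf : measurable_fun setT f.
  apply: (measurableT_comp_product mg); apply: measurable_fun_dfwith => //.
  by apply: measurable_fun_dfwith => // k; exact: measurable_cst.
rewrite (fubini_tonelli (m1 := mu i) (m2 := mu j) f mf (fun=> g0 _)).
apply: eq_integral => z _; apply: eq_integral => y _.
by rewrite /f dfwithC.
Qed.

Lemma foldr_int_coord_tonelli s g :
  tonelli_integrand g -> tonelli_integrand (foldr (int_coord mu) g s).
Proof. by move=> tg; elim: s => //= i s; exact: int_coord_tonelli. Qed.

Lemma foldr_int_coord_perm s1 s2 g : tonelli_integrand g -> perm_eq s1 s2 ->
  foldr (int_coord mu) g s1 = foldr (int_coord mu) g s2.
Proof.
move=> tg; elim: s1 s2 => [|i s1 IH] s2; first by rewrite perm_sym => /perm_nilP ->.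
move=> p12; have /splitPr s2i : i \in s2 by rewrite -(perm_mem p12) mem_head.
case: s2i p12 => t1 t2; rewrite perm_sym perm_catC cat_cons perm_cons perm_catC.
rewrite perm_sym => /IH /= ->; rewrite !foldr_cat /=.
elim: t1 => //= j t1 <-; apply: int_coordC.
by do 2!apply: foldr_int_coord_tonelli.
Qed.

Lemma foldr_int_coord0 s :
  foldr (int_coord mu) (fun=> 0%E) s = (fun=> 0%E : \bar R).
Proof.
elim: s => //= i s ->; apply: functional_extensionality_dep => x.
by rewrite /int_coord integral0.
Qed.

(** The factors other than [w] are constant in coordinate [w] and leave the integral; the remaining
    factor is a conditional density, so it integrates to 1. *)
Lemma int_coord_prod (f : I -> X -> R) (P : pred I) w : P w ->
  (forall j, P j -> conditional_density mu j (f j)) ->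
  (forall j x y, P j -> j != w -> f j (dfwith x w y) = f j x) ->
  int_coord mu w (fun x => (\prod_(j | P j) f j x)%:E) =
  (fun x => (\prod_(j | P j && (j != w)) f j x)%:E).
Proof.
move=> Pw df fw; apply: functional_extensionality_dep => x.
have [mf f0 f1] := df w Pw.
rewrite /int_coord.
under eq_integral => y _.
  rewrite (bigD1 w)//= mulrC EFinM.
  under eq_bigr => j /andP[Pj jw] do rewrite fw//.
  over.
rewrite ge0_integralZl_EFin//=.
- by move: (f1 x); rewrite /int_coord => ->; rewrite mule1.
- by move=> y _; rewrite lee_fin.
- apply/measurable_EFinP.
  by apply: (measurableT_comp_product mf); apply: measurable_fun_dfwith.
- by apply: prodr_ge0 => j /andP[/df[]].
Qed.

(* Summing out variables in reverse topological order, so that at each step only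
   one factor depends on the variable integrated; Tonelli frees the order. *)
Lemma marginal_ancestral (f : I -> X -> R) (P : I -> {set I}) (rk : I -> nat)
    (U : {set I}) :
  (forall i j, i \in P j -> (rk i < rk j)%N) ->
  (forall i, conditional_density mu i (f i)) ->
  (forall i x y, (forall j, j \in i |: P i -> x j = y j) -> f i x = f i y) ->
  (forall j, j \in U -> P j \subset U) ->
  marginal mu (fun x => \prod_j f j x) U = (fun x => (\prod_(j in U) f j x)%:E).
Proof.
move=> rkP df fP UP; rewrite /marginal /int_over.
have fw i w x y : w != i -> w \notin P i -> f i (dfwith x w y) = f i x.
  move=> wi wP; apply: fP => j; rewrite finset.in_setU1 => jP.
  rewrite dfwithout//; apply: contraNneq wP => wj; move: jP.
  by rewrite -wj (negPf wi).
have tg (Q : pred I) :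
    tonelli_integrand (fun x : X => (\prod_(j | Q j) f j x)%:E).
  split; last by move=> x; rewrite lee_fin; apply: prodr_ge0 => j _; case: (df j).
  apply/measurable_EFinP.
  apply: (eq_measurable_fun (fun x : mX =>
    \prod_(j <- [seq j <- index_enum I | Q j]) f j x)).
    by move=> x _; rewrite big_filter.
  by apply: measurable_prod => j _; case: (df j).
pose le_rk := relpre rk leq.
(* [foldr] puts the last entry innermost, so sorting by increasing rank integrates out variables of
   highest rank first. *)
pose s := sort le_rk (enum (~: U)%SET).
have mem_s i : (i \in s) = (i \notin U) by rewrite mem_sort mem_enum finset.in_setC.
rewrite (@foldr_int_coord_perm _ s _ (tg _)); last first.
  by rewrite perm_sym perm_sort.
have pw_s : pairwise le_rk s.
  rewrite -sorted_pairwise; last by move=> j i k; exact: leq_trans.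
  by apply: sort_sorted => i j; exact: leq_total.
have uniq_s : uniq s by rewrite sort_uniq enum_uniq.
have sU : {subset s <= (~: U)%SET} by move=> i; rewrite finset.in_setC mem_s.
(* The index set of the product is expressed through [s], so that it shrinks along with [s] in the
   induction. *)
transitivity (foldr (int_coord mu)
    (fun x : X => (\prod_(j | (j \in U) || (j \in s)) f j x)%:E) s).
  congr foldr; apply: functional_extensionality_dep => x; congr EFin.
  by apply: eq_bigl => j; rewrite mem_s orbN.
move: s {mem_s} pw_s uniq_s sU.
elim/last_ind => [_ _ _|s w IH] /=.
  apply: functional_extensionality_dep => x.
  by congr EFin; apply: eq_bigl => j; rewrite orbF.
rewrite pairwise_rcons rcons_uniq => /andP[/allP rks pws] /andP[ws us] sU.
have wU : w \notin U by rewrite -finset.in_setC sU// mem_rcons mem_head.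
rewrite foldr_rcons (int_coord_prod (f := f)); first last.
(* No remaining factor [j] has [w] as a parent: if [j] is in [U], because [U] is ancestral and omits
   [w]; if [j] is in [s], because its rank is at most that of [w]. *)
- move=> j x y jUs jw; apply: fw; first by rewrite eq_sym.
  move: jUs; rewrite mem_rcons in_cons (negPf jw) /= => /orP[jU|/rks jw'].
    by apply: contraNN wU; exact/fintype.subsetP/UP.
  by apply: contraL jw' => /rkP; rewrite /le_rk /= ltnNge.
- by move=> j _; exact: df.
- by rewrite mem_rcons mem_head orbT.
rewrite -IH //; last by move=> j js; rewrite sU// mem_rcons in_cons js orbT.
congr foldr; apply: functional_extensionality_dep => x; congr EFin.
apply: eq_bigl => j; rewrite mem_rcons in_cons.
by have [->|_] := eqVneq j w; rewrite ?(negPf wU) ?(negPf ws) ?andbF ?andbT.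
Qed.

End ProductIntegral.

(** * Acyclicity, complete structures and their equivalence *)

Section Structures.
Variable n : nat.
Implicit Types (S C : dag n) (i j k : 'I_n).

Lemma pa_acyclic S i j : i \in pa S j -> ~~ connect (dag_arc S) j i.
Proof.
by move=> ij; have /forallP/(_ i)/forallP/(_ j)/implyP := dag_acyclic S; exact.
Qed.

Lemma pa_irrefl S i : i \notin pa S i.
Proof. by apply/negP => /pa_acyclic; rewrite connect0. Qed.

Definition depth S j := #|[set k | connect (dag_arc S) k j]%SET|.

(** Ancestors of [i] are ancestors of [j], while [j] is its own ancestor but, by acyclicity, not one
    of [i]. Thus [depth] can serve as the rank in [marginal_ancestral]. *)
Lemma depth_pa S i j : i \in pa S j -> (depth S i < depth S j)%N.
Proof.
move=> ij; apply/proper_card/properP; split.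
  apply/fintype.subsetP => k; rewrite !inE => /connect_trans; apply.
  exact: connect1.
by exists j; rewrite inE ?connect0 ?pa_acyclic.
Qed.

(** Completeness joins [k] and [j] by an arc, and an arc from [j] to [k] would close a cycle. Hence
    parent sets in a complete structure are ancestral. *)
Lemma complete_pa_trans C i j k :
  complete_dag C -> k \in pa C i -> i \in pa C j -> k \in pa C j.
Proof.
move=> cC ki ij; have [kj|kj] := eqVneq k j.
  have := pa_acyclic ij; rewrite -kj => /negP[].
  exact: connect1.
have /orP[//|jk] := cC _ _ kj.
have /negP[] := pa_acyclic jk.
by apply: (connect_trans (connect1 ki)); exact: connect1.
Qed.

Lemma rank_acyclic (rk : 'I_n -> nat) :
  acyclic [ffun j => [set i | (rk i < rk j)%N]%SET].
Proof.
apply/forallP => i; apply/forallP => j; apply/implyP.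
rewrite /dag_arc ffunE inE => ij; apply/negP => /connectP[p].
elim: p j ij => [|k p IH] j ij /= => [_ ji|/andP[jk pk] il].
  by rewrite ji ltnn in ij.
apply: (IH k) => //; apply: ltn_trans ij _.
by rewrite /dag_arc ffunE inE in jk.
Qed.

Lemma complete_dag_same_parents S i :
  exists2 C, complete_dag C & pa C i = pa S i.
Proof.
(* Three disjoint blocks of ranks: parents of [i] below [n], [i] at [n], all others above.
   Injectivity of [rk] gives completeness. *)
pose rk j := if j \in pa S i then j : nat else if j == i then n else (n.+1 + j)%N.
have rk_inj j k : rk j = rk k -> j = k.
  rewrite /rk; have [jn kn] := (ltn_ord j, ltn_ord k).
  case: (j \in pa S i); case: (k \in pa S i);
    have [ji|_] := eqVneq j i; have [ki|_] := eqVneq k i => E;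
    by [apply: val_inj => /=; lia | rewrite ji ki].
have paE j : pa (Dag (rank_acyclic rk)) j = [set k | (rk k < rk j)%N]%SET.
  by rewrite /pa ffunE.
exists (Dag (rank_acyclic rk)) => [j k jk|].
  by rewrite !paE !inE -neq_ltn; apply: contraNneq jk => /rk_inj ->.
apply/setP => j; rewrite paE inE /rk (negPf (pa_irrefl S i)) eqxx.
have jn := ltn_ord j.
by case: (j \in pa S i); case: (j == i); lia.
Qed.

(** In a complete structure every predecessor is a parent, so each assertion concerns the empty set
    and holds for every distribution. *)
Lemma complete_independence_equivalent (R : realType) C1 C2 :
  complete_dag C1 -> complete_dag C2 -> independence_equivalent R C1 C2.
Proof.
have sat C (V : finType) (P : {ffun 'I_n -> V} -> R) :
    complete_dag C -> satisfies_assertions P C.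
  move=> cC o oC i v.
  have -> : ([set j : 'I_n | (o j < o i)%N] :\: pa C i)%SET = finset.set0.
    apply/setP => j; rewrite !inE; apply/negP => /andP[jC ji].
    have /cC/orP[|/oC ij] : j != i by apply: contraTneq ji => ->; rewrite ltnn.
      exact/negP.
    by have := ltn_trans ji ij; rewrite ltnn.
  by rewrite finset.setU0 finset.set0U.
by move=> c1 c2 A B C; split=> H V P jP _; apply: H => //; exact: sat.
Qed.

End Structures.

(** * Local likelihoods as conditionals in complete structures *)

Section Models.
Variables (R : realType) (n : nat) (d : 'I_n -> measure_display).
Variables (T : forall i, measurableType (d i)).
Variables (mu : forall i, {sigma_finite_measure set (T i) -> \bar R}).
Variables (F : forall i : 'I_n, set ((forall j, T j) -> R)) (M : bn_model R T).

Lemma same_lpar_llik (m1 m2 : local_model R T)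
    (t1 : 'rV[R]_(ldim m1)) (t2 : 'rV[R]_(ldim m2)) :
  same_lpar t1 t2 -> llik t1 = llik t2.
Proof. exact: (congr1 (fun p => llik (projT2 p))). Qed.

Lemma same_lpar_dom (m1 m2 : local_model R T)
    (t1 : 'rV[R]_(ldim m1)) (t2 : 'rV[R]_(ldim m2)) :
  same_lpar t1 t2 -> ldom t1 -> ldom t2.
Proof. by move/(congr1 (fun p => ldom (projT2 p))) => /= ->. Qed.

Lemma same_lpar_transport (m1 m2 : local_model R T) (t1 : 'rV[R]_(ldim m1)) :
  m1 = m2 -> exists t2 : 'rV[R]_(ldim m2), same_lpar t2 t1.
Proof. by move=> m12; subst m2; exists t1. Qed.

(** Over an empty domain the prior would vanish identically and integrate to 0 instead of 1. *)
Lemma param_dom_nonempty S :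
  prior_densities M -> exists theta : params M S, param_dom theta.
Proof.
move=> /(_ S)[[_ _ int1] prior0]; apply: contrapT => dom0.
have /eqP := int1 (fun=> 0).
have -> : EFin \o (fun t => prior (b := M) (S := S) (\row_j t j)) = fun=> 0%E.
  apply: funext => t /=; rewrite prior0// => dom.
  by apply: dom0; exists (\row_j t j).
by rewrite /int_over foldr_int_coord0 eq_sym onee_eq0.
Qed.

(** Both [pa C i] and [i |: pa C i] are ancestral, so their marginals are products of local
    likelihoods that differ by the factor of [i] alone; [parents_possible] makes the common part
    positive, hence cancellable. *)
Lemma conditional_lik C (psi : params M C) i :
  local_likelihoods_in mu M F -> parents_possible mu M ->
  complete_dag C -> param_dom psi ->
  conditional mu (lik psi) i (pa C i) = llik (lpar psi i).
Proof.
move=> [Fd Fl] pp cC dpsi.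
have anc (U : {set 'I_n}) : (forall j, j \in U -> pa C j \subset U) ->
    marginal mu (lik psi) U = fun x => (\prod_(j in U) llik (lpar psi j) x)%:E.
  apply: (marginal_ancestral (f := fun j => llik (lpar psi j)) (@depth_pa _ C)).
    by move=> j; apply/Fd/(Fl C j _ (dpsi j)).1.
  by move=> j; exact: (Fl C j _ (dpsi j)).2.
have anc_pa j : j \in pa C i -> pa C j \subset pa C i.
  by move=> ji; apply/fintype.subsetP => k kj; exact: complete_pa_trans kj ji.
apply: funext => x; rewrite /conditional anc ?anc//=; last first.
  move=> j; rewrite finset.in_setU1 => /predU1P[->|/anc_pa ji].
    exact: finset.subsetUr.
  exact: fintype.subset_trans ji (finset.subsetUr _ _).
have := pp C psi dpsi i x; rewrite anc// lte_fin => prod_gt0.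
by rewrite big_setU1 ?pa_irrefl//= mulfK// gt_eqF.
Qed.

Lemma exists_complete_extension S i (t : 'rV[R]_(ldim (loc M S i))) :
  prior_densities M -> likelihood_modularity M -> ldom t ->
  exists (C : dag n) (psi : params M C),
    [/\ complete_dag C, pa C i = pa S i, param_dom psi & same_lpar (lpar psi i) t].
Proof.
move=> pd lm dt; have [C cC paC] := complete_dag_same_parents S i.
have [t' tt'] := same_lpar_transport t (lm _ _ _ (esym paC)).
have [psi0 dpsi0] := param_dom_nonempty C pd.
have dt' : ldom t' by apply: same_lpar_dom dt; exact: esym.
(* The parameter domain is a product over the variables, so block [i] of [psi0] can be replaced by
   [t']. *)
exists C, (\mxrow_j dfwith (lpar psi0) i t' j); split=> //.
  move=> j; rewrite /lpar mxrowK.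
  by have [<-|ij] := eqVneq i j; [rewrite dfwithin | rewrite dfwithout//; exact: dpsi0].
by rewrite /lpar mxrowK dfwithin.
Qed.

End Models.

(** * Recovering the likelihood of any structure from a complete one *)

Theorem theorem3 (R : realType) (n : nat) (d : 'I_n -> measure_display)
  (T : forall i, measurableType (d i))
  (mu : forall i, {sigma_finite_measure set (T i) -> \bar R})
  (F : forall i : 'I_n, set ((forall j, T j) -> R))
  (M : bn_model R T) :
  structures_possible M ->
  local_likelihoods_in mu M F ->
  prior_densities M ->
  parents_possible mu M ->
  local_parameters_identified M ->
  reparametrizations M ->
  likelihood_modularity M ->
  covered_arc_reversal_equivalence M ->
  marginal_likelihood_equivalence M ->
  forall Sc S : dag n, complete_dag Sc ->
  exists phi : forall i : 'I_n, 'rV[R]_(ldim (loc M S i)) -> (forall j, T j) -> R,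
    [/\ forall i, set_bij (ldom (l := loc M S i))
          [set conditional mu (lik thetac) i (pa S i) | thetac in param_dom (M := M) (S := Sc)]
          (phi i),
        forall i t, ldom t ->
          (exists (C : dag n) (psi : params M C),
             [/\ complete_dag C, pa C i = pa S i, param_dom psi & same_lpar (lpar psi i) t]) /\
          forall (C : dag n) (psi : params M C),
             complete_dag C -> pa C i = pa S i -> param_dom psi -> same_lpar (lpar psi i) t ->
             phi i t =
               conditional mu (lik (repar Sc psi : params M Sc)) i (pa S i) &
        forall theta : params M S, param_dom theta -> forall x,
          lik theta x = \prod_(i < n) phi i (lpar theta i) x].
Proof.
move=> _ lF pd pp lid _ lm _ mle Sc S cSc.
have to_Sc C (psi : params M C) : complete_dag C -> param_dom psi ->
    param_dom (repar Sc psi : params M Sc) /\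
    lik (repar Sc psi : params M Sc) = lik psi.
  move=> cC dpsi; have CSc := complete_independence_equivalent R cC cSc.
  by have [dS likS _] := mle _ _ CSc _ dpsi; split=> //; exact: funext.
have llikE i t (C : dag n) (psi : params M C) :
    complete_dag C -> pa C i = pa S i -> param_dom psi ->
    same_lpar (lpar psi i) t ->
    llik (l := loc M S i) t =
      conditional mu (lik (repar Sc psi : params M Sc)) i (pa S i).
  move=> cC paC dpsi /same_lpar_llik <-.
  have [_ ->] := to_Sc _ _ cC dpsi.
  by rewrite -paC (conditional_lik _ lF pp cC dpsi).
exists (fun i => llik (l := loc M S i)); split=> // [i|i t dt]; last first.
  split; first exact: exists_complete_extension.
  exact: llikE.
split=> [t dt||_ [thetac dthetac <-]].
(* Values of [phi i] are conditionals of [Sc]: extend [t] to a complete structure and carry the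
   extension over to [Sc]. *)
- have [C [psi [cC paC dpsi tt]]] := exists_complete_extension pd lm dt.
  exists (repar Sc psi : params M Sc); first by have [] := to_Sc _ _ cC dpsi.
  by rewrite (llikE i t C psi).
- exact: lid.
(* Surjectivity runs the other way: [thetac] is carried from [Sc] to [C], and its local parameter at
   [i] is transported to [S] by modularity. *)
have [C cC paC] := complete_dag_same_parents S i.
have [dpsi likpsi _] :=
  mle _ _ (complete_independence_equivalent R cSc cC) _ dthetac.
have [t tt] := same_lpar_transport (lpar (repar C thetac : params M C) i)
  (lm _ _ _ paC).
exists t; first by apply: same_lpar_dom (dpsi i); exact: esym.
rewrite (same_lpar_llik tt) -(conditional_lik _ lF pp cC dpsi) paC.
by congr conditional; exact: funext.
Qed.
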